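(* Let $T_1,\dots,T_k\colon[0,1]\to[0,1]$ ($k\ge2$) be continuous maps such that (i) the target set $A_{\mathrm t}$ of $\mathrm{IFS}(T_1,\dots,T_k)$ has at least two elements, and (ii) there is a non-trivial closed interval $J\subset[0,1]$ such that $T_i(J)\subset J$ and $T_i|_J$ is injective for every $i\in\{1,\dots,k\}$. Then for every (non-trivial) Bernoulli probability $\mathfrak b$ on $\Sigma_k^+$, $\mathrm{IFS}(T_1,\dots,T_k;\mathfrak b)$ is asymptotically stable. Moreover, $\pi_*\mathfrak b$ is the unique stationary measure of $\mathrm{IFS}(T_1,\dots,T_k;\mathfrak b)$, it satisfies $\mathrm{supp}(\pi_*\mathfrak b)=\overline{A_{\mathrm t}}$, and it is continuous. As a consequence, the set $A_{\mathrm t}$ has no isolated points.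
   Context: Let $X=[0,1]$ and $\Sigma_k^+=\{1,\dots,k\}^{\mathbb N}$. The set of weakly hyperbolic sequences is $S_{\mathrm t}=\{\xi\in\Sigma_k^+ : \lim_{n\to\infty}\mathrm{diam}(T_{\xi_0}\circ\cdots\circ T_{\xi_n}(X))=0\}$. The coding map $\pi\colon S_{\mathrm t}\to X$ is $\pi(\xi)=\lim_{n\to\infty}T_{\xi_0}\circ\cdots\circ T_{\xi_n}(p)$, which does not depend on $p\in X$. The target set is $A_{\mathrm t}=\pi(S_{\mathrm t})$. A (non-trivial) Bernoulli probability $\mathfrak b=\mathfrak b(p_1,\dots,p_k)$ is the product measure on $\Sigma_k^+$ with strictly positive weights $p_1,\dots,p_k$, $\sum_i p_i=1$. $\pi_*\mathfrak b$ is the Borel measure $B\mapsto\mathfrak b(\pi^{-1}(B))$ on $X$, where $\pi^{-1}(B)\subset S_{\mathrm t}$. A measure is continuous if it has no atoms. $\mathcal M_1(X)$ is the space of Borel probability measures on $X$ with the weak$*$ topology. The Markov operator of $\mathrm{IFS}(T_1,\dots,T_k;\mathfrak b)$ is $\mathfrak T_{\mathfrak b}\colon\mathcal M_1(X)\to\mathcal M_1(X)$, $\mathfrak T_{\mathfrak b}\mu=\sum_{i=1}^k p_i\,T_{i*}\mu$, where $T_{i*}\mu(A)=\mu(T_i^{-1}(A))$. A stationary measure is a fixed point of $\mathfrak T_{\mathfrak b}$. $\mathrm{IFS}(T_1,\dots,T_k;\mathfrak b)$ is asymptotically stable if there is a stationary measure $\nu$ such that $\lim_{n\to\infty}\mathfrak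 T_{\mathfrak b}^n\mu=\nu$ (weak$*$) for every $\mu\in\mathcal M_1(X)$. *)

(* Defs.v *)
From HB Require Import structures.
From mathcomp Require Import all_boot all_order all_algebra.
From mathcomp Require Import all_classical all_reals all_analysis.
From mathcomp Require Import measurable_realfun giry lra.

Set Implicit Arguments.
Unset Strict Implicit.
Unset Printing Implicit Defensive.

Import Order.TTheory GRing.Theory Num.Theory.
Import numFieldNormedType.Exports.

Local Open Scope classical_set_scope.
Local Open Scope ring_scope.

(* [unit_itv R] is a type of its own, so that open sets, closures and the Borel
   sigma-algebra are those of [0, 1] and not those of the real line. *)
Definition unit_itv (R : realType) : Type := set_type (`[0, 1]%classic : set R).

HB.instance Definition _ (R : realType) := PseudoMetric.on (unit_itv R).

Lemma unit_itv0_subproof (R : realType) : (0 : R) \in (`[0, 1]%classic : set R).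
Proof. by rewrite inE /= in_itv /= lexx ler01. Qed.

Definition unit_itv0 (R : realType) : unit_itv R :=
  exist _ 0 (unit_itv0_subproof R).

HB.instance Definition _ (R : realType) :=
  isPointed.Build (unit_itv R) (unit_itv0 R).

HB.instance Definition _ (R : realType) :=
  Measurable.copy (unit_itv R) (g_sigma_algebraType (@open (unit_itv R))).

(* The symbols 1, ..., k of the alphabet are the elements of ['I_k], starting
   from 0; the alphabet is ['I_k.+1] because a measurable type is nonempty. *)
Definition symbol_seq (k : nat) : Type := nat -> 'I_k.+1.

HB.instance Definition _ (k : nat) := Choice.copy (symbol_seq k) (nat -> 'I_k.+1).

HB.instance Definition _ (k : nat) :=
  isPointed.Build (symbol_seq k) (fun=> ord0).

Definition coordinate_cylinders (k : nat) : set (set (symbol_seq k)) :=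
  [set C | exists n i, C = [set xi | xi n = i]].

HB.instance Definition _ (k : nat) :=
  Measurable.copy (symbol_seq k) (g_sigma_algebraType (@coordinate_cylinders k)).

Definition is_bernoulli_weight (R : realType) (k : nat) (p : 'I_k.+1 -> R) :=
  (forall i, 0 < p i) /\ \sum_i p i = 1.

Definition is_bernoulli (R : realType) (k : nat) (p : 'I_k.+1 -> R)
    (b : probability (symbol_seq k) R) :=
  forall (n : nat) (w : 'I_n -> 'I_k.+1),
    b [set xi | forall j : 'I_n, xi j = w j] = (\prod_(j < n) p (w j))%:E.

Definition diameter (R : realType) (A : set (unit_itv R)) : R :=
  sup [set `|val x - val y| | x in A & y in A].

(* [comp_upto T xi n] is T_{xi 0} \o ... \o T_{xi n}, with n + 1 factors. *)
Fixpoint comp_upto (X : Type) (k : nat) (T : 'I_k.+1 -> X -> X)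
    (xi : symbol_seq k) (n : nat) : X -> X :=
  if n is m.+1 then comp_upto T xi m \o T (xi m.+1) else T (xi 0%N).

Definition weakly_hyperbolic (R : realType) (k : nat)
    (T : 'I_k.+1 -> unit_itv R -> unit_itv R) : set (symbol_seq k) :=
  [set xi | diameter (range (comp_upto T xi n)) @[n --> \oo] --> (0 : R)].

(* The base point 0 is immaterial on [weakly_hyperbolic T]: see
   [cvg_coding_map]. Outside of that set the value is meaningless and is never
   used. *)
Definition coding_map (R : realType) (k : nat)
    (T : 'I_k.+1 -> unit_itv R -> unit_itv R) (xi : symbol_seq k) : unit_itv R :=
  lim (comp_upto T xi n (unit_itv0 R) @[n --> \oo]).

Definition target_set (R : realType) (k : nat)
    (T : 'I_k.+1 -> unit_itv R -> unit_itv R) : set (unit_itv R) :=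
  coding_map T @` weakly_hyperbolic T.

Definition coding_law (R : realType) (k : nat)
    (T : 'I_k.+1 -> unit_itv R -> unit_itv R)
    (b : set (symbol_seq k) -> \bar R) (B : set (unit_itv R)) : \bar R :=
  b (weakly_hyperbolic T `&` coding_map T @^-1` B).

Definition markov_fun (R : realType) (k : nat)
    (T : 'I_k.+1 -> unit_itv R -> unit_itv R) (p : 'I_k.+1 -> R)
    (mu : set (unit_itv R) -> \bar R) (A : set (unit_itv R)) : \bar R :=
  (\sum_i (p i)%:E * pushforward mu (T i) A)%E.

Definition msupport (R : realType) (m : set (unit_itv R) -> \bar R) :
    set (unit_itv R) :=
  [set x | forall U, open U -> U x -> (0 < m U)%E].

Definition no_atom (R : realType) (m : set (unit_itv R) -> \bar R) :=
  forall x, m [set x] = 0%E.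

Definition weak_cvg (R : realType) (mu_ : nat -> probability (unit_itv R) R)
    (nu : probability (unit_itv R) R) :=
  forall f : unit_itv R -> R, continuous f ->
    \int[mu_ n]_x f x @[n --> \oo] --> \int[nu]_x f x.

Lemma ler_diameter (R : realType) (A : set (unit_itv R)) x y :
  A x -> A y -> `|val x - val y| <= diameter A.
Proof.
move=> Ax Ay; apply: ub_le_sup; last by exists x => //; exists y.
exists 1 => _ [u _ [v _ <-]].
have /set_mem := valP u; have /set_mem := valP v.
rewrite /= !in_itv /= => /andP[v0 v1] /andP[u0 u1].
by rewrite ler_norml; apply/andP; split; lra.
Qed.

Lemma diameter_ge0 (R : realType) (A : set (unit_itv R)) : 0 <= diameter A.
Proof.
have [->|/set0P[x Ax]] := eqVneq A set0.
  rewrite /diameter (_ : [set _ | _ in _ & _ in _] = set0) ?sup0//.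
  by apply/seteqP; split => // z [? []].
by rewrite (le_trans _ (ler_diameter Ax Ax)).
Qed.

Lemma range_comp_upto (X : Type) (k : nat) (T : 'I_k.+1 -> X -> X)
    (xi : symbol_seq k) (n m : nat) : (n <= m)%N ->
  range (comp_upto T xi m) `<=` range (comp_upto T xi n).
Proof.
move=> /subnK <-; elim: (m - n)%N => // j IH _ [x _ <-] /=.
by apply: IH; exists (T (xi (j + n).+1) x).
Qed.

Lemma eq_comp_upto (X : Type) (k : nat) (T : 'I_k.+1 -> X -> X)
    (xi xi' : symbol_seq k) (n : nat) : (forall j, (j <= n)%N -> xi j = xi' j) ->
  comp_upto T xi n = comp_upto T xi' n.
Proof.
elim: n => [|n IH] xiE /=; first by rewrite xiE.
by rewrite xiE// IH// => j jn; rewrite xiE// (leq_trans jn).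
Qed.

Lemma measurable_coordinate (k n : nat) (i : 'I_k.+1) :
  measurable [set xi : symbol_seq k | xi n = i].
Proof. by apply: sub_sigma_algebra; exists n, i. Qed.

Lemma measurable_finite_coordinates (k n : nat) (A : set (symbol_seq k)) :
  (forall xi xi' : symbol_seq k,
    (forall j, (j < n)%N -> xi j = xi' j) -> A xi -> A xi') ->
  measurable A.
Proof.
elim: n A => [|n IH] A AE.
  have [->|/set0P[xi Axi]] := eqVneq A set0; first exact: measurable0.
  rewrite (_ : A = setT); first exact: measurableT.
  by apply/seteqP; split => // xi' _; apply: AE Axi.
pose upd (xi : symbol_seq k) i : symbol_seq k :=
  fun j => if j == n then i else xi j.
rewrite (_ : A = \bigcup_(i in [set: 'I_k.+1])
    ([set xi | xi n = i] `&` [set xi | A (upd xi i)])); last first.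
  have updE xi : upd xi (xi n) = xi.
    by apply/funext => j; rewrite /upd; case: eqP => // ->.
  apply/seteqP; split => [xi Axi|xi [i _ [/= <-]]]; last by rewrite updE.
  by exists (xi n) => //; split => //=; rewrite updE.
apply: fin_bigcup_measurable => // i _; apply: measurableI.
  exact: measurable_coordinate.
apply: IH => xi xi' xiE /=; apply: AE => j; rewrite ltnS leq_eqVlt /upd.
by case: eqVneq => //= _; exact: xiE.
Qed.

Section coding.
Context (R : realType) (k : nat) (T : 'I_k.+1 -> unit_itv R -> unit_itv R).

Lemma measurable_weakly_hyperbolic : measurable (weakly_hyperbolic T).
Proof.
pose d (xi : symbol_seq k) n := diameter (range (comp_upto T xi n)).
rewrite (_ : weakly_hyperbolic T = \bigcap_m \bigcup_N \bigcap_(n in [set n | (N <= n)%N])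
    [set xi | d xi n < m.+1%:R^-1]); last first.
  apply/seteqP; split => [xi /cvgrPdist_lt dxi m _|xi dxi].
    have [|N _ NP] := dxi m.+1%:R^-1; first by rewrite invr_gt0.
    exists N => // n /NP; rewrite sub0r normrN ger0_norm//.
    exact: diameter_ge0.
  apply/cvgrPdist_lt => e e0.
  have [m _ me] := near_infty_natSinv_lt (PosNum e0).
  have [N _ NP] := dxi m I; exists N => // n Nn.
  rewrite sub0r normrN ger0_norm ?diameter_ge0//.
  exact: lt_trans (NP n Nn) (me m (leqnn m)).
apply: bigcapT_measurable => m; apply: bigcupT_measurable => N.
apply: bigcap_measurable => [|n _]; first by exists N => /=.
apply: (@measurable_finite_coordinates _ n.+1) => xi xi' xiE /=.
by rewrite /d (eq_comp_upto T xiE).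
Qed.

Lemma cvg_unit_itv (u : nat -> unit_itv R) (l : R) :
  val (u n) @[n --> \oo] --> l ->
  exists2 x : unit_itv R, val x = l & u n @[n --> \oo] --> x.
Proof.
move=> ul.
have lI : l \in (`[0, 1]%classic : set R).
  have cI : closed (`[0, 1]%classic : set R) by exact: itv_closed.
  have uI : \forall n \near \oo, (`[0, 1]%classic : set R) (val (u n)).
    by apply: nearW => n; exact/set_mem/valP.
  apply: mem_set; exact: (closed_cvg _ cI uI _ ul).
exists (exist _ l lI) => //.
by apply/cvg_ballP => e e0; move/cvg_ballP : ul; exact.
Qed.

Lemma cvg_coding_map (xi : symbol_seq k) (q : unit_itv R) :
  weakly_hyperbolic T xi -> comp_upto T xi n q @[n --> \oo] --> coding_map T xi.
Proof.
move=> /cvgrPdist_lt hxi.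
pose u q n := val (comp_upto T xi n q).
have cauchyu e : 0 < e -> exists N, forall m n q q', (N <= m)%N -> (N <= n)%N ->
    `|u q m - u q' n| < e.
  move=> e0; have [N _ NP] := hxi e e0; exists N => m n q1 q2 Nm Nn.
  have := NP N (leqnn N); rewrite sub0r normrN ger0_norm ?diameter_ge0//.
  by apply: le_lt_trans; apply: ler_diameter;
    [apply: (range_comp_upto Nm)|apply: (range_comp_upto Nn)]; eexists.
have [l ul] : exists l : R, u (unit_itv0 R) n @[n --> \oo] --> l.
  apply/cvg_ex/cauchy_cvgP/cauchy_exP => e e0.
  have [N NP] := cauchyu e e0.
  by exists (u (unit_itv0 R) N), N => // n /= Nn; exact: NP.
have [x _ ux] := cvg_unit_itv ul.
have : comp_upto T xi n (unit_itv0 R) @[n --> \oo] --> coding_map T xi.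
  by apply/cvg_ex; exists x.
move=> /cvg_ballP c; apply/cvg_ballP => e e0.
have e20 : 0 < e / 2 by rewrite divr_gt0.
have [N NP] := cauchyu _ e20.
have [N' _ N'P] := c _ e20.
exists (maxn N N') => // n /=; rewrite geq_max => /andP[Nn N'n].
apply: ball_split (N'P n N'n) _.
exact: NP.
Qed.

Lemma measurable_coding_map : measurable_fun (weakly_hyperbolic T) (coding_map T).
Proof.
have mval : measurable_fun (weakly_hyperbolic T) (val \o coding_map T : _ -> R).
  apply: (@measurable_fun_cvg _ _ _ _
    (fun n xi => val (comp_upto T xi n (unit_itv0 R)))) => [n mD A mA|xi hxi].
    apply: measurableI => //; apply: (@measurable_finite_coordinates _ n.+1).
    by move=> xi xi' xiE /=; rewrite (eq_comp_upto T xiE).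
  have /cvg_ballP c := cvg_coding_map (unit_itv0 R) hxi.
  by apply/cvg_ballP => e e0; exact: c.
apply: (@measurability _ _ _ _ _ _ (@open (unit_itv R))) => //.
move=> _ [_ [V oV <-] <-].
rewrite -comp_preimage; apply: mval.
  exact: measurable_weakly_hyperbolic.
exact: open_measurable.
Qed.

End coding.

Section coding_law_measure.
Local Open Scope ereal_scope.
Context (R : realType) (k : nat) (T : 'I_k.+1 -> unit_itv R -> unit_itv R).
Variable b : {measure set (symbol_seq k) -> \bar R}.

Let mpre (B : set (unit_itv R)) : measurable B ->
  measurable (weakly_hyperbolic T `&` coding_map T @^-1` B).
Proof.
by move=> mB; apply: measurable_coding_map => //;
  exact: measurable_weakly_hyperbolic.
Qed.

Let coding_law0 : coding_law T b set0 = 0.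
Proof. by rewrite /coding_law preimage_set0 setI0 measure0. Qed.

Let coding_law_ge0 B : 0 <= coding_law T b B.
Proof. exact: measure_ge0. Qed.

Let coding_law_sigma_additive : semi_sigma_additive (coding_law T b).
Proof.
move=> F mF tF mUF; rewrite /coding_law preimage_bigcup setI_bigcupr.
apply: measure_semi_sigma_additive.
- by move=> n; exact: mpre.
- apply/trivIsetP => i j _ _ ij; rewrite setIACA setIid -preimage_setI.
  by move/trivIsetP : tF => /(_ _ _ I I ij) ->; rewrite preimage_set0 setI0.
- by rewrite -setI_bigcupr -preimage_bigcup; exact: mpre.
Qed.

HB.instance Definition _ := isMeasure.Build _ _ _ (coding_law T b)
  coding_law0 coding_law_ge0 coding_law_sigma_additive.

End coding_law_measure.

Section markov_operator.
Local Open Scope ereal_scope.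
Context (R : realType) (k : nat) (T : 'I_k.+1 -> unit_itv R -> unit_itv R)
  (p : 'I_k.+1 -> R).
Hypotheses (cT : forall i, continuous (T i)) (hp : is_bernoulli_weight p).
Variable mu : probability (unit_itv R) R.

Let mT i : measurable_fun setT (T i).
Proof.
apply: (@measurability _ _ _ _ _ _ (@open (unit_itv R))) => //.
move=> _ [V oV <-]; rewrite setTI; apply: sub_sigma_algebra.
by apply: open_comp oV => x _; apply: cT.
Qed.

Let mpre i A : measurable A -> measurable (T i @^-1` A).
Proof. by move=> mA; rewrite -[X in measurable X]setTI; exact: mT. Qed.

Let p0 i : 0 <= (p i)%:E.
Proof. by rewrite lee_fin ltW//; have [] := hp. Qed.

Let markov0 : markov_fun T p mu set0 = 0.
Proof.
by rewrite /markov_fun big1// => i _; rewrite /pushforward preimage_set0 measure0 mule0.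
Qed.

Let markov_ge0 A : 0 <= markov_fun T p mu A.
Proof.
by apply: sume_ge0 => i _; apply: mule_ge0 => //; exact: measure_ge0.
Qed.

Let markov_sigma_additive : semi_sigma_additive (markov_fun T p mu).
Proof.
move=> F mF tF mUF.
rewrite [X in X @ _ --> _](_ : _ = fun n =>
    \sum_i (p i)%:E * \sum_(0 <= j < n) pushforward mu (T i) (F j)); last first.
  apply/funext => n; rewrite /markov_fun exchange_big/=.
  by apply: eq_bigr => i _; rewrite ge0_sume_distrr// => j _; exact: measure_ge0.
apply: cvg_nnesum => [i _|i _].
  apply: nearW => n; apply: mule_ge0 => //; apply: sume_ge0 => j _.
  exact: measure_ge0.
apply: cvgeZl => //.
apply: (measure_semi_sigma_additive (fun j => T i @^-1` F j)) => [j||].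
- exact: mpre.
- apply/trivIsetP => j l _ _ jl; rewrite -preimage_setI.
  by move/trivIsetP : tF => /(_ _ _ I I jl) ->; rewrite preimage_set0.
- by rewrite -preimage_bigcup; exact: mpre.
Qed.

Let markov_setT : markov_fun T p mu setT = 1.
Proof.
rewrite /markov_fun (eq_bigr (fun i => (p i)%:E)) => [|i _].
  by rewrite sumEFin; have [_ ->] := hp.
by rewrite /pushforward preimage_setT probability_setT mule1.
Qed.

Let markov_measure := markov_fun T p mu.

HB.instance Definition _ := isMeasure.Build _ _ _ markov_measure
  markov0 markov_ge0 markov_sigma_additive.

HB.instance Definition _ :=
  Measure_isProbability.Build _ _ _ markov_measure markov_setT.

Definition markov_operator : probability (unit_itv R) R := markov_measure.

End markov_operator.

(* The values of a [probability] on nonmeasurable sets carry no meaning, so two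
   probability measures are equal when they are related by [≡μ]. *)
Definition stationary (R : realType) (k : nat)
    (T : 'I_k.+1 -> unit_itv R -> unit_itv R) (p : 'I_k.+1 -> R)
    (cT : forall i, continuous (T i)) (hp : is_bernoulli_weight p)
    (mu : probability (unit_itv R) R) :=
  markov_operator cT hp mu ≡μ mu.

Definition asymptotically_stable (R : realType) (k : nat)
    (T : 'I_k.+1 -> unit_itv R -> unit_itv R) (p : 'I_k.+1 -> R)
    (cT : forall i, continuous (T i)) (hp : is_bernoulli_weight p) :=
  exists2 nu, stationary cT hp nu &
    forall mu, weak_cvg (fun n => iter n (markov_operator cT hp) mu) nu.

(* Main.v *)
From HB Require Import structures.
Require Import Defs.
From mathcomp Require Import all_boot all_order all_algebra.
From mathcomp Require Import all_classical all_reals all_analysis.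
From mathcomp Require Import measurable_realfun giry lra.

Set Implicit Arguments.
Unset Strict Implicit.
Unset Printing Implicit Defensive.

Import Order.TTheory GRing.Theory Num.Theory.
Import numFieldNormedType.Exports.

Local Open Scope classical_set_scope.
Local Open Scope ring_scope.

(** No map is assumed to contract; stability comes from two words [u], [v] of
    the same length whose images are disjoint and lie in the segment [J] on
    which all the maps are injective ([splitting_words]). They exist because
    [target_set T] is contained in [J] and has no isolated point
    ([target_set_limit]): a long prefix [w] of a weakly hyperbolic sequence has
    its image close to the coded point, and [word_map T w] sends target points
    to target points and, being injective on [J], keeps two of them apart.

    Fix a point [x] and a word [w]. By injectivity on [J], [x] belongs to the
    image of at most one of [w ++ u] and [w ++ v]. Hence extending a random word
    by a random block multiplies the probability that its image contains [x] by
    at most [1 - d], where [d > 0] is the smaller of the weights of [u] and [v],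
    and this probability tends to 0 ([cvg_hit_mean]). Images of words are
    intervals, so an image longer than [e] contains a point of a fixed finite
    grid; therefore the probability that the image of a random word is longer
    than [e] tends to 0 too ([cvg_wide_mean]), and almost every sequence is
    weakly hyperbolic ([weakly_hyperbolic_ae]).

    The law of the coding map is then known on closed sets: the probability that
    the image of a random word of length [n] meets [F] decreases to
    [coding_law T b F] ([cvg_hit_coding_law]). For [F] a point the limit is 0,
    so there are no atoms. Conditioning on the first letter of the word gives
    stationarity. Any stationary [mu] satisfies [mu F <= P(image meets F)] for
    every [n], so [mu] is below [coding_law T b] on closed sets, which forces
    equality ([closed_le_measure_eq]).

    Finally, the integrals of a continuous [f] against the [n]-th iterate of an
    initial law and against a stationary law differ by at most twice the mean
    oscillation of [f] over the images of words of length [n]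
    ([iter_markov_dist]). By uniform continuity and [cvg_wide_mean] this tends
    to 0, which is asymptotic stability ([weak_cvg_iter_markov]). *)

(** * Words and their weighted means *)

Section words.
Context (X : Type) (k : nat) (T : 'I_k.+1 -> X -> X).

(** Composition in the order of reading, so that appending letters to a word
    shrinks the image of [word_map]. *)
Definition word_map (w : seq 'I_k.+1) : X -> X :=
  foldr (fun i g => T i \o g) id w.

Lemma word_map_cat u v : word_map (u ++ v) = word_map u \o word_map v.
Proof. by elim: u => //= i u ->. Qed.

Lemma comp_uptoE xi n : comp_upto T xi n = word_map (mkseq xi n.+1).
Proof.
elim: n => [//|n IH]; rewrite mkseqS -cats1 word_map_cat -IH.
by apply/funext => x.
Qed.

Lemma range_word_map_cat u v :
  range (word_map (u ++ v)) `<=` range (word_map u).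
Proof. by rewrite word_map_cat => _ [x _ <-]; exists (word_map v x). Qed.

Lemma range_word_map_mkseq xi n m : (n <= m)%N ->
  range (word_map (mkseq xi m)) `<=` range (word_map (mkseq xi n)).
Proof.
move=> nm; have -> : mkseq xi m = mkseq xi n ++ map xi (iota n (m - n)).
  by rewrite /mkseq -map_cat -[X in iota X (_ - _)]add0n -iotaD subnKC.
exact: range_word_map_cat.
Qed.

End words.

Lemma word_map_closed (X : Type) (k : nat) (T : 'I_k.+1 -> X -> X)
    (J : set X) w :
  (forall i, T i @` J `<=` J) -> word_map T w @` J `<=` J.
Proof.
move=> TJ; elim: w => [|i w IH] _ [x Jx <-] //=.
by apply: (TJ i); exists (word_map T w x) => //; apply: IH; exists x.
Qed.

Lemma word_map_inj (X : Type) (k : nat) (T : 'I_k.+1 -> X -> X)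
    (J : set X) w :
  (forall i, T i @` J `<=` J) -> (forall i, set_inj J (T i)) ->
  set_inj J (word_map T w).
Proof.
move=> TJ Tinj; elim: w => [|i w IH] x y /set_mem Jx /set_mem Jy //= Txy.
apply: IH; rewrite ?inE//; apply: (Tinj i) => //; rewrite inE;
  by apply: (word_map_closed (w := w) TJ); eexists; [|reflexivity].
Qed.

Section word_mean.
Context (R : realType) (k : nat) (p : 'I_k.+1 -> R).

(** The mean of [F] over a random word made of [n] independent letters of law
    [p], conditioning on the first letter. *)
Fixpoint word_mean (n : nat) (F : seq 'I_k.+1 -> R) : R :=
  if n is m.+1 then \sum_i p i * word_mean m (fun w => F (i :: w)) else F [::].

Definition word_weight (w : seq 'I_k.+1) : R := \prod_(i <- w) p i.

Lemma word_mean_cat n m F :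
  word_mean (n + m) F =
  word_mean n (fun u => word_mean m (fun v => F (u ++ v))).
Proof.
elim: n F => [//|n IH] F /=.
by apply: eq_bigr => i _; rewrite IH.
Qed.

Lemma word_meanZ c n F : word_mean n (fun w => c * F w) = c * word_mean n F.
Proof.
elim: n F => [//|n IH] F /=; rewrite mulr_sumr; apply: eq_bigr => i _.
by rewrite IH mulrCA.
Qed.

Lemma word_meanD n F G :
  word_mean n (fun w => F w + G w) = word_mean n F + word_mean n G.
Proof.
elim: n F G => [//|n IH] F G /=; rewrite -big_split/=; apply: eq_bigr => i _.
by rewrite IH mulrDr.
Qed.

Lemma word_mean_sum (J : Type) (r : seq J) n (F : J -> seq 'I_k.+1 -> R) :
  word_mean n (fun w => \sum_(j <- r) F j w) =
  \sum_(j <- r) word_mean n (F j).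
Proof.
elim: n F => [//|n IH] F /=; rewrite exchange_big/=; apply: eq_bigr => i _.
by rewrite IH mulr_sumr.
Qed.

Hypothesis hp : is_bernoulli_weight p.

Let p_ge0 i : 0 <= p i. Proof. by rewrite ltW//; case: hp. Qed.

Lemma word_weight_gt0 w : 0 < word_weight w.
Proof. by rewrite /word_weight; apply: prodr_gt0 => i _; case: hp. Qed.

Lemma le_word_mean n F G : (forall w, size w = n -> F w <= G w) ->
  word_mean n F <= word_mean n G.
Proof.
elim: n F G => [|n IH] F G FG /=; first exact: FG.
apply: ler_sum => i _; rewrite ler_wpM2l//; apply: IH => w wn.
by apply: FG; rewrite /= wn.
Qed.

Lemma eq_word_mean n F G : (forall w, size w = n -> F w = G w) ->
  word_mean n F = word_mean n G.
Proof.
by move=> FG; apply/eqP; rewrite eq_le !le_word_mean// => w wn; rewrite FG.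
Qed.

Lemma word_mean_cst n c : word_mean n (fun=> c) = c.
Proof.
elim: n => [//|n IH] /=; rewrite IH -mulr_suml.
by have [_ ->] := hp; rewrite mul1r.
Qed.

Lemma word_mean_ge0 n F : (forall w, 0 <= F w) -> 0 <= word_mean n F.
Proof.
by move=> F0; rewrite -(word_mean_cst n 0); apply: le_word_mean => w _.
Qed.

Lemma word_mean_eq u :
  word_mean (size u) (fun w => (w == u)%:R) = word_weight u.
Proof.
elim: u => [|i u IH] /=; first by rewrite /word_weight big_nil.
rewrite /word_weight big_cons (bigD1 i)//= big1 ?addr0 => [|j /negPf ji].
  by rewrite -/(word_weight u) -IH; congr (_ * _); apply: eq_word_mean => w _;
     rewrite eqseq_cons eqxx.
rewrite (@eq_word_mean _ _ (fun=> 0)) ?word_mean_cst ?mulr0// => w _.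
by rewrite eqseq_cons ji.
Qed.

Lemma word_weight_le1 u : word_weight u <= 1.
Proof.
rewrite -word_mean_eq -[leRHS](word_mean_cst (size u)).
by apply: le_word_mean => w _; case: (w == u).
Qed.

End word_mean.

(** * Bernoulli measures of events read on a prefix *)

Section bernoulli_prefix.
Context (R : realType) (k : nat) (p : 'I_k.+1 -> R).
Hypothesis hp : is_bernoulli_weight p.
Variable b : probability (symbol_seq k) R.
Hypothesis hb : is_bernoulli p b.

Lemma measurable_prefix n (A : set (seq 'I_k.+1)) :
  measurable [set xi : symbol_seq k | A (mkseq xi n)].
Proof.
apply: (@measurable_finite_coordinates _ n) => xi xi' xiE /=.
suff -> : mkseq xi n = mkseq xi' n by [].
by apply/eq_in_map => j; rewrite mem_iota => /andP[_ jn]; exact: xiE.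
Qed.

Lemma bernoulli_cylinder w :
  b [set xi | mkseq xi (size w) = w] = (word_weight p w)%:E.
Proof.
rewrite /word_weight (big_nth ord0) big_mkord -(hb (fun j => nth ord0 w j)).
congr (b _); apply/seteqP; split => xi /=.
  by move=> <- j; rewrite nth_mkseq// -[X in (_ < X)%N](size_mkseq xi (size w)).
move=> xiE; apply: (@eq_from_nth _ ord0); rewrite size_mkseq// => j jw.
by rewrite nth_mkseq// (xiE (Ordinal jw)).
Qed.

(** The prescribed prefix [w] makes the induction on the number [n] of free
    letters go through: the step splits the event by the letter that follows
    [w], which is then moved into the prefix. *)
Lemma bernoulli_cylinder_prefix w n (A : pred (seq 'I_k.+1)) :
  b [set xi | mkseq xi (size w) = w /\ A (mkseq xi (size w + n))] =
  (word_weight p w * word_mean p n (fun v => (A (w ++ v))%:R))%:E.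
Proof.
elim: n w => [|n IH] w /=.
  rewrite cats0; have [Aw|/negPf Aw] := boolP (A w).
    rewrite mulr1 -bernoulli_cylinder; congr (b _).
    by apply/seteqP; split => xi /= => [[]//|wE]; rewrite addn0 wE.
  rewrite mulr0 -[RHS](measure0 b); congr (b _).
  by apply/seteqP; split => xi //= [wE]; rewrite addn0 wE Aw.
pose E i := [set xi : symbol_seq k | mkseq xi (size (rcons w i)) = rcons w i /\
  A (mkseq xi (size (rcons w i) + n))].
have wE i : word_weight p (rcons w i) = word_weight p w * p i.
  by rewrite /word_weight -cats1 big_cat/= big_seq1.
have -> : [set xi : symbol_seq k | mkseq xi (size w) = w /\
    A (mkseq xi (size w + n.+1))] = \big[setU/set0]_(i < k.+1) E i.
  rewrite -bigcup_seq.
  apply/seteqP; split => [xi /= [wxi Axi]|xi [i _ [/=]]].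
    exists (xi (size w)); first by rewrite /= mem_index_enum.
    by rewrite /E /= size_rcons addSnnS; split => //; rewrite mkseqS wxi.
  by rewrite size_rcons addSnnS mkseqS => /rcons_inj[wxi _].
have mE i : measurable (E i).
  apply: measurableI.
    exact: (@measurable_prefix (size (rcons w i)) [set rcons w i]).
  exact: (@measurable_prefix (size (rcons w i) + n) [set v | A v]).
rewrite measure_bigsetU_ord//; last first.
  apply/trivIsetP => i j _ _ /eqP ij.
  apply/seteqP; split => // xi [[+ _] [+ _]].
  by rewrite !size_rcons => ->/rcons_inj[].
rewrite mulr_sumr -sumEFin; apply: eq_bigr => i _.
rewrite [LHS]IH wE -mulrA; congr (_ * (_ * _))%:E.
by apply: eq_word_mean => // v _; rewrite cat_rcons.
Qed.

(** Reduces the almost sure properties of sequences to estimates of finite sums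
    over words. *)
Lemma bernoulli_prefix n (A : pred (seq 'I_k.+1)) :
  b [set xi | A (mkseq xi n)] = (word_mean p n (fun v => (A v)%:R))%:E.
Proof.
have := bernoulli_cylinder_prefix [::] n A.
rewrite /word_weight big_nil mul1r add0n => <-; congr (b _).
by apply/seteqP; split => xi /= => [Axi|[]].
Qed.

End bernoulli_prefix.

(** * Topology of the unit interval *)

Section unit_interval.
Context (R : realType).
Implicit Types x y : unit_itv R.

Lemma val_itv01 x : 0 <= val x <= 1.
Proof. by have /set_mem := valP x; rewrite /= in_itv. Qed.

Lemma unit_itv_ballE x e y : ball x e y = (`|val x - val y| < e).
Proof. by []. Qed.

Lemma continuous_val : continuous (val : unit_itv R -> R).
Proof. exact: initial_continuous. Qed.

Lemma unit_itv_hausdorff : hausdorff_space (unit_itv R).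
Proof.
rewrite ball_hausdorff => x y /eqP xy.
have xy' : 0 < `|val x - val y| / 2.
  by rewrite divr_gt0// normr_gt0 subr_eq0; apply/eqP => /val_inj.
exists (PosNum xy', PosNum xy') => /=; apply/eqP/seteqP; split => // z [/=].
rewrite !unit_itv_ballE /= => xz yz.
have := ler_distD (val z) (val x) (val y).
rewrite (distrC (val z)) leNgt => /negP; apply.
by rewrite [ltRHS](splitr `|val x - val y|) ltrD.
Qed.

Lemma clip_subproof (t : R) :
  Num.max 0 (Num.min t 1) \in (`[0, 1]%classic : set R).
Proof.
by rewrite inE /= in_itv /= le_max lexx/= ge_max ler01/= ge_min lexx orbT.
Qed.

(** A retraction of the line onto the interval, which carries compactness and
    connectedness over from the segment of the real line. *)
Definition clip (t : R) : unit_itv R :=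
  exist _ (Num.max 0 (Num.min t 1)) (clip_subproof t).

Lemma clipK t : 0 <= t <= 1 -> val (clip t) = t.
Proof. by move=> /andP[t0 t1] /=; rewrite min_l// max_r. Qed.

Let continuous_clip : continuous clip.
Proof.
move=> t; apply/cvg_ballP => e e0.
have : continuous ((fun=> 0 : R^o) \max (id \min (fun=> 1)) : R -> R^o).
  move=> u; apply: continuous_max; first exact: cvg_cst.
  by apply: continuous_min; [exact: cvg_id|exact: cvg_cst].
by move=> /(_ t) /cvg_ballP; exact.
Qed.

Let range_clip : clip @` `[0, 1]%classic = setT.
Proof.
apply/seteqP; split => // x _; exists (val x); first exact/set_mem/valP.
by apply/val_inj/clipK/val_itv01.
Qed.

Lemma unit_itv_compact : compact [set: unit_itv R].
Proof.
rewrite -range_clip; apply: continuous_compact; last exact: segment_compact.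
exact: continuous_subspaceT.
Qed.

Lemma unit_itv_connected : connected [set: unit_itv R].
Proof.
rewrite -range_clip; apply: connected_continuous_connected.
  by apply/connected_intervalP; exact: interval_is_interval.
exact: continuous_subspaceT.
Qed.

Lemma closed_range (g : unit_itv R -> unit_itv R) :
  continuous g -> closed (range g).
Proof.
move=> cg; apply: compact_closed; first exact: unit_itv_hausdorff.
apply: continuous_compact unit_itv_compact; exact: continuous_subspaceT.
Qed.

(** The intermediate value theorem: the image is connected. *)
Lemma range_interval (g : unit_itv R -> unit_itv R) x y z :
  continuous g -> range g x -> range g y -> val x <= val z <= val y ->
  range g z.
Proof.
move=> cg [x' _ <-] [y' _ <-] xzy.
have /connected_intervalP int : connected (range (val \o g)).
  apply: connected_continuous_connected; first exact: unit_itv_connected.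
  apply: continuous_subspaceT => u.
  by apply: (@continuous_comp _ _ _ g val); [exact: cg|exact: continuous_val].
have [u _ /val_inj <-] : range (val \o g) (val z).
  by apply: int xzy; [exists x'|exists y'].
by exists u.
Qed.

(** Heine's theorem, as a covering of the interval by balls on which [f] varies
    by less than [e / 2]. *)
Lemma unit_itv_uniform_continuity (f : unit_itv R -> R) e :
  continuous f -> 0 < e -> exists2 d, 0 < d &
    forall x y, `|val x - val y| < d -> `|f x - f y| < e.
Proof.
move=> cf e0.
have e20 : 0 < e / 2 by rewrite divr_gt0.
have := @compact_near_coveringP (unit_itv R) setT.
move=> [/(_ unit_itv_compact) + _].
move=> /(_ R (0^'+)
  (fun d x => forall y, `|val x - val y| < d -> `|f x - f y| < e)); case.
- move=> x _; have /cvg_ballP/(_ _ e20) := cf x.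
  rewrite -nbhs_ballE => -[r /= r0 rf].
  have r20 : 0 < r / 2 by rewrite divr_gt0.
  exists (ball x (r / 2), [set d | d < r / 2]); first split => /=.
  + exact: nbhsx_ballx.
  + exact: nbhs_right_lt.
  move=> [x' d] [/= xx' dr] y x'y.
  have fx' : `|f x - f x'| < e / 2.
    apply: rf; apply: le_ball xx'; lra.
  have fy : `|f x - f y| < e / 2.
    apply: rf; rewrite unit_itv_ballE; rewrite unit_itv_ballE in xx'.
    apply: (le_lt_trans (ler_distD (val x') _ _)); lra.
  apply: (le_lt_trans (ler_distD (f x) _ _)); rewrite (distrC (f x')); lra.
- move=> d /= d0 dP; exists (d / 2); first by rewrite divr_gt0.
  move=> x y; apply: (dP (d / 2)) => //=; last by rewrite divr_gt0.
  by rewrite sub0r normrN gtr0_norm ?divr_gt0//; lra.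
Qed.

Lemma unit_itv_bounded (f : unit_itv R -> R) :
  continuous f -> exists C, forall x, `|f x| <= C.
Proof.
move=> cf; have : compact (range f).
  by apply: continuous_compact unit_itv_compact; exact: continuous_subspaceT.
move=> /compact_bounded[M [_ Mf]]; exists (M + 1) => x.
by apply: (Mf (M + 1)); [rewrite ltrDl|exists x].
Qed.

End unit_interval.

Section diameter.
Context (R : realType).
Implicit Types (A B : set (unit_itv R)).

Lemma diameter_le A B : A `<=` B -> diameter A <= diameter B.
Proof.
move=> AB; have [->|/set0P[x Ax]] := eqVneq A set0.
  rewrite {1}/diameter (_ : [set _ | _ in _ & _ in _] = set0) ?sup0.
    exact: diameter_ge0.
  by apply/seteqP; split => // z [? []].
apply: ge_sup; first by exists 0, x => //; exists x => //; rewrite subrr normr0.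
by move=> _ [u Au [v Av <-]]; apply: ler_diameter; exact: AB.
Qed.

Lemma lt_diameter A e : 0 <= e -> e < diameter A ->
  exists x y, [/\ A x, A y & e < val y - val x].
Proof.
move=> e0 eA.
have supA : has_sup [set `|val x - val y| | x in A & y in A].
  split; last first.
    exists 1 => _ [u _ [v _ <-]].
    have /andP[u0 u1] := val_itv01 u; have /andP[v0 v1] := val_itv01 v.
    by rewrite ler_norml; apply/andP; split; lra.
  apply/set0P/negP => /eqP A0.
  by move: eA; rewrite /diameter A0 sup0 ltNge e0.
have e'0 : 0 < diameter A - e by rewrite subr_gt0.
have [_ [x Ax [y Ay <-]]] := sup_adherent e'0 supA.
rewrite -/(diameter A) opprB addrC subrK.
have [yx|xy] := leP (val y) (val x).
  by rewrite ger0_norm ?subr_ge0// => ?; exists y, x.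
by rewrite distrC gtr0_norm ?subr_gt0// => ?; exists x, y.
Qed.

End diameter.

(** * The target set has no isolated point *)

Section target_set.
Context (R : realType) (k : nat) (T : 'I_k.+1 -> unit_itv R -> unit_itv R).
Hypothesis cT : forall i, continuous (T i).
Implicit Types (xi : symbol_seq k) (J : set (unit_itv R)).

Lemma continuous_word_map w : continuous (word_map T w).
Proof.
elim: w => [|i w IH] x; first exact: cvg_id.
by apply: (@continuous_comp _ _ _ (word_map T w) (T i)); [exact: IH|exact: cT].
Qed.

Lemma closed_range_word_map w : closed (range (word_map T w)).
Proof. by apply: closed_range; exact: continuous_word_map. Qed.

(** The coded point belongs to the image of every prefix, since these images
    are closed and nested. *)
Lemma coding_map_range xi n : weakly_hyperbolic T xi ->
  range (word_map T (mkseq xi n)) (coding_map T xi).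
Proof.
move=> hxi; have near_range : \forall m \near \oo,
    range (word_map T (mkseq xi n)) (comp_upto T xi m (unit_itv0 R)).
  exists n => // m /= nm; rewrite comp_uptoE.
  by apply: (range_word_map_mkseq (leqW nm)); exists (unit_itv0 R).
exact: (closed_cvg _ (@closed_range_word_map (mkseq xi n)) near_range _
  (cvg_coding_map (unit_itv0 R) hxi)).
Qed.

Lemma coding_map_diameter xi n x : weakly_hyperbolic T xi ->
  range (word_map T (mkseq xi n)) x ->
  `|val (coding_map T xi) - val x| <=
  diameter (range (word_map T (mkseq xi n))).
Proof. by move=> hxi; apply: ler_diameter; exact: coding_map_range. Qed.

Lemma near_coding_map xi e : weakly_hyperbolic T xi -> 0 < e ->
  \forall n \near \oo, forall x, range (word_map T (mkseq xi n)) x ->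
    `|val (coding_map T xi) - val x| < e.
Proof.
move=> hxi e0; have /cvgr0Pnorm_lt/(_ _ e0) [N _ NP] := hxi.
exists N.+1 => // -[//|n] Nn x Tx.
apply: (le_lt_trans (coding_map_diameter hxi Tx)).
by have := NP n Nn; rewrite comp_uptoE ger0_norm ?diameter_ge0.
Qed.

Lemma target_set_sub J : closed J -> J !=set0 -> (forall i, T i @` J `<=` J) ->
  target_set T `<=` J.
Proof.
move=> cJ [q Jq] TJ _ [xi hxi <-].
have near_J : \forall n \near \oo, J (comp_upto T xi n q).
  apply: nearW => n; rewrite comp_uptoE.
  by apply: (word_map_closed (w := mkseq xi n.+1) TJ); exists q.
exact: (closed_cvg _ cJ near_J _ (cvg_coding_map q hxi)).
Qed.

Definition prepend (i : 'I_k.+1) xi : symbol_seq k :=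
  fun n => if n is m.+1 then xi m else i.

Lemma comp_upto_prepend i xi n :
  comp_upto T (prepend i xi) n.+1 = T i \o comp_upto T xi n.
Proof.
rewrite !comp_uptoE /mkseq -[iota 0 n.+2]/(0%N :: iota 1 n.+1) (iotaDl 1 0).
by rewrite /= -map_comp.
Qed.

(** By uniform continuity, [T i] maps small sets to small sets. *)
Lemma weakly_hyperbolic_prepend i xi :
  weakly_hyperbolic T xi -> weakly_hyperbolic T (prepend i xi).
Proof.
move=> hxi; apply/cvgr0Pnorm_lt => e e0.
have e20 : 0 < e / 2 by rewrite divr_gt0.
have cf : continuous (val \o T i : unit_itv R -> R).
  by move=> u; apply: (@continuous_comp _ _ _ (T i) val);
    [exact: cT|exact: continuous_val].
have [d d0 dP] := unit_itv_uniform_continuity cf e20.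
have /cvgr0Pnorm_lt/(_ _ d0) [N _ NP] := hxi.
exists N.+1 => // -[//|n] Nn; rewrite comp_upto_prepend.
rewrite ger0_norm ?diameter_ge0// ltNge; apply/negP => ele.
have : e / 2 < diameter (range (T i \o comp_upto T xi n)) by lra.
move=> /(lt_diameter (ltW e20)) [_ [_ [[x _ <-] [y _ <-]]]].
rewrite ltNge => /negP; apply; rewrite (le_trans (ler_norm _))//.
apply/ltW/dP; have := NP n Nn; rewrite ger0_norm ?diameter_ge0//.
by apply: le_lt_trans; apply: ler_diameter; [exists y|exists x].
Qed.

Lemma coding_map_prepend i xi : weakly_hyperbolic T xi ->
  coding_map T (prepend i xi) = T i (coding_map T xi).
Proof.
move=> hxi; pose q := unit_itv0 R.
have c1 := cvg_coding_map q (weakly_hyperbolic_prepend i hxi).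
have c2 : comp_upto T (prepend i xi) n.+1 q @[n --> \oo] -->
    T i (coding_map T xi).
  rewrite (_ : (fun n => _) = T i \o (fun n => comp_upto T xi n q)).
    by apply: cvg_comp; [exact: (cvg_coding_map q hxi)|exact: cT].
  by apply/funext => n; rewrite comp_upto_prepend.
apply: (@cvg_unique _ (@unit_itv_hausdorff R)
  (comp_upto T (prepend i xi) n.+1 q @[n --> \oo]) _) => //=.
by rewrite (cvg_shiftS (fun n => comp_upto T (prepend i xi) n q)).
Qed.

Lemma target_set_word_map w y :
  target_set T y -> target_set T (word_map T w y).
Proof.
elim: w => [//|i w IH] /IH [xi hxi /= <-].
exists (prepend i xi); first exact: weakly_hyperbolic_prepend.
exact: coding_map_prepend.
Qed.

Variable J : set (unit_itv R).
Hypothesis cJ : closed J.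
Hypothesis J0 : J !=set0.
Hypothesis TJ : forall i, T i @` J `<=` J.
Hypothesis Tinj : forall i, set_inj J (T i).
Hypothesis hA : exists x y, [/\ target_set T x, target_set T y & x <> y].

(** A long prefix [w] of a sequence coding [x] has its image close to [x], and
    this image contains the images of two distinct target points; these images
    are target points, and they are distinct because [target_set T] lies in
    [J], where [word_map T w] is injective. *)
Lemma target_set_limit x e : target_set T x -> 0 < e ->
  exists2 y, target_set T y & x <> y /\ `|val x - val y| < e.
Proof.
move=> [xi hxi <-] e0.
have [N _ /(_ N (leqnn N)) NP] := near_coding_map hxi e0.
have [y [z [Ay Az yz]]] := hA.
set w := mkseq xi N in NP.
have [xy|xy] := pselect (coding_map T xi = word_map T w y); last first.
  exists (word_map T w y); first exact: target_set_word_map.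
  by split => //; apply: NP; exists y.
exists (word_map T w z); first exact: target_set_word_map.
split; last by apply: NP; exists z.
rewrite xy => /(word_map_inj TJ Tinj) yz'; apply: yz.
by apply: yz'; rewrite inE; exact: (target_set_sub cJ J0 TJ).
Qed.

Lemma isolated_target_set : isolated (target_set T) = set0.
Proof.
apply/seteqP; split => // x [/set_mem Ax [V]].
rewrite -nbhs_ballE => -[e /= e0 eV] VA.
have [y Ay [xy xye]] := target_set_limit Ax e0.
have : (V `&` target_set T) y by split => //; exact: eV.
by rewrite VA => /= yx; apply: xy.
Qed.

End target_set.

(** * Images of random words become small *)

Section synchronization.
Context (R : realType) (k : nat) (T : 'I_k.+1 -> unit_itv R -> unit_itv R).
Hypothesis cT : forall i, continuous (T i).
Variable J : set (unit_itv R).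
Hypothesis TJ : forall i, T i @` J `<=` J.
Hypothesis Tinj : forall i, set_inj J (T i).

Definition hit (F : set (unit_itv R)) (w : seq 'I_k.+1) : bool :=
  `[< F `&` range (word_map T w) !=set0 >].

Lemma hit_cat F u v : hit F (u ++ v) -> hit F u.
Proof.
move=> /asboolP [x [Fx Tx]]; apply/asboolP; exists x; split => //.
exact: range_word_map_cat Tx.
Qed.

Lemma hit_cons F i w : hit F (i :: w) = hit (T i @^-1` F) w.
Proof.
apply/asboolP/asboolP => [[x [Fx [y _ yx]]]|[x [Fx [y _ yx]]]].
  by exists (word_map T w y); split; [rewrite /preimage/= -yx in Fx *|exists y].
by exists (T i x); split => //; exists y => //=; rewrite yx.
Qed.

Variable p : 'I_k.+1 -> R.
Hypothesis hp : is_bernoulli_weight p.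

Lemma hit_mean_noninc F n m : (n <= m)%N ->
  word_mean p m (fun w => (hit F w)%:R) <=
  word_mean p n (fun w => (hit F w)%:R).
Proof.
move=> /subnKC <-; rewrite word_mean_cat; apply: le_word_mean => // w _.
rewrite -[leRHS](word_mean_cst hp (m - n)); apply: le_word_mean => // v _.
by have := @hit_cat F w v; case: (hit F (w ++ v)) => [->|_]//.
Qed.

Variables u v : seq 'I_k.+1.
Hypothesis uv : size u = size v.
Hypothesis uJ : range (word_map T u) `<=` J.
Hypothesis vJ : range (word_map T v) `<=` J.
Hypothesis uv0 : range (word_map T u) `&` range (word_map T v) = set0.

Let d := Num.min (word_weight p u) (word_weight p v).

Let d_gt0 : 0 < d.
Proof. by rewrite lt_min !word_weight_gt0. Qed.

Let d_le1 : d <= 1.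
Proof.
by rewrite ge_min word_weight_le1.
Qed.

Let d'_ge0 : 0 <= 1 - d. Proof. by rewrite subr_ge0. Qed.

(** Both images lie in [J], where [word_map T w] is injective, so it keeps them
    disjoint; on the whole interval the maps may fail to be injective. *)
Lemma not_hit_both x w :
  ~~ hit [set x] (w ++ u) \/ ~~ hit [set x] (w ++ v).
Proof.
have [/asboolP [_ [-> [y _ yx]]]|] := boolP (hit [set x] (w ++ u));
  last by left.
right; apply/negP => /asboolP [_ [-> [z _ zx]]].
move: yx zx; rewrite !word_map_cat /= => <- zy.
have : (range (word_map T u) `&` range (word_map T v)) (word_map T u y).
  split; first by exists y.
  exists z => //; apply: (word_map_inj TJ Tinj (w := w)) => //; rewrite inE.
    by apply: vJ; exists z.
  by apply: uJ; exists y.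
by rewrite uv0.
Qed.

(** Images decrease along a word, so a block can only lose [x], and it does
    lose it when it is the one of [u], [v] that misses [x]. *)
Lemma hit_mean_block x w :
  word_mean p (size u) (fun w' => (hit [set x] (w ++ w'))%:R) <=
  (1 - d) * (hit [set x] w)%:R.
Proof.
have [hw|hw] := boolP (hit [set x] w); last first.
  rewrite mulr0 -(word_mean_cst hp (size u) 0) le_word_mean// => w' _.
  have := @hit_cat [set x] w w'; rewrite (negPf hw).
  by case: hit => // /(_ isT).
rewrite mulr1.
have avoid s : size s = size u -> d <= word_weight p s ->
    ~~ hit [set x] (w ++ s) ->
  word_mean p (size u) (fun w' => (hit [set x] (w ++ w'))%:R) <= 1 - d.
  move=> su ds ns; apply: (@le_trans _ _ (1 - word_weight p s)); last by lra.
  rewrite -word_mean_eq// su lerBrDr -word_meanD.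
  rewrite -[leRHS](word_mean_cst hp (size u)).
  apply: le_word_mean => // w' _; have [->|_] := eqVneq w' s.
    by rewrite (negPf ns) add0r.
  by rewrite addr0; case: hit.
have [|] := not_hit_both x w; apply: avoid => //; by rewrite ge_min lexx ?orbT.
Qed.

Lemma hit_mean_decay x m :
  word_mean p (m * size u) (fun w => (hit [set x] w)%:R) <= (1 - d) ^+ m.
Proof.
elim: m => [|m IH]; first by rewrite mul0n expr0 /=; case: hit.
rewrite mulSn addnC word_mean_cat exprS.
apply: le_trans (ler_wpM2l d'_ge0 IH).
by rewrite -word_meanZ; apply: le_word_mean => // w _; exact: hit_mean_block.
Qed.

Lemma cvg_hit_mean x :
  word_mean p n (fun w => (hit [set x] w)%:R) @[n --> \oo] --> (0 : R).
Proof.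
apply/cvgr0Pnorm_lt => e e0.
have d1 : `|1 - d| < 1 by rewrite ger0_norm// ltrBlDr ltrDl.
have /cvgr0Pnorm_lt/(_ _ e0) [m _ mP] := cvg_expr d1.
exists (m * size u)%N => // n /= mn.
rewrite ger0_norm; last by apply: word_mean_ge0 => // w; case: hit.
apply: le_lt_trans (hit_mean_noninc _ mn) _.
apply: le_lt_trans (hit_mean_decay _ _) _.
by have := mP m (leqnn m); rewrite /= ger0_norm// exprn_ge0.
Qed.

Definition wide (e : R) (w : seq 'I_k.+1) : bool :=
  e < diameter (range (word_map T w)).

Lemma wide_hit_grid (e : R) (m : nat) w : m.+1%:R^-1 < e -> wide e w ->
  exists j : 'I_m.+2, hit [set clip (j%:R / m.+1%:R)] w.
Proof.
move=> me ew; have m0 : 0 < m.+1%:R :> R by rewrite ltr0n.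
have mi0 : 0 < m.+1%:R^-1 :> R by rewrite invr_gt0.
have e0 : 0 < e by exact: lt_trans me.
have [x [y [Tx Ty exy]]] := lt_diameter (ltW e0) ew.
have /andP[x0 x1] := val_itv01 x; have /andP[y0 y1] := val_itv01 y.
have xm0 : 0 <= val x * m.+1%:R by rewrite mulr_ge0// ltW.
have /andP[lo hi] := truncn_itv xm0.
(* [j.+1] is the first grid index to the right of [x]; as the image reaches
   [x + e] and the mesh is less than [e], the grid point is still in it *)
set j := Num.truncn _ in lo hi.
have jx : val x <= j.+1%:R / m.+1%:R by rewrite ler_pdivlMr// ltW.
have jy : j.+1%:R / m.+1%:R <= val y.
  rewrite -natr1 mulrDl mul1r.
  have jx' : j%:R / m.+1%:R <= val x by rewrite ler_pdivrMr.
  apply: (le_trans (lerD jx' (ltW me))); lra.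
have jm : (j.+1 < m.+2)%N.
  by rewrite ltnS -(ler_nat R) -[leRHS]mul1r -ler_pdivrMr// (le_trans jy).
exists (Ordinal jm); apply/asboolP; exists (clip (j.+1%:R / m.+1%:R)).
split => //; have cj : val (clip (j.+1%:R / m.+1%:R)) = j.+1%:R / m.+1%:R :> R.
  by apply: clipK; rewrite (le_trans x0 jx) (le_trans jy y1).
apply: (range_interval (continuous_word_map cT (w := w)) Tx Ty).
by rewrite cj jx jy.
Qed.

(** Connectedness reduces wide images to finitely many points. *)
Lemma cvg_wide_mean (e : R) : 0 < e ->
  word_mean p n (fun w => (wide e w)%:R) @[n --> \oo] --> (0 : R).
Proof.
move=> e0.
have [m _ /(_ m (leqnn m)) /= me] := near_infty_natSinv_lt (PosNum e0).
pose h n := \sum_(j < m.+2) word_mean p n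
  (fun w => (hit [set clip (j%:R / m.+1%:R)] w)%:R).
apply: (@squeeze_cvgr _ _ _ _ (fun=> 0) h); last 2 first.
- exact: cvg_cst.
- have <- : \sum_(j < m.+2) (0 : R) = 0 by rewrite big1.
  by apply: cvg_big => [|j _]; [exact: add_continuous|exact: cvg_hit_mean].
apply: nearW => n; apply/andP; split.
  by apply: word_mean_ge0 => // w; case: wide.
rewrite /h -word_mean_sum; apply: le_word_mean => // w _.
have [/(wide_hit_grid me) [j hj]|_] := boolP (wide e w); last first.
  by apply: sumr_ge0 => j _; case: hit.
by rewrite (bigD1 j)//= hj lerDl; apply: sumr_ge0 => i _; case: hit.
Qed.

End synchronization.

(** * Two words with disjoint images in the segment *)

Lemma between_of_dist_lt (R : realType) (l r x t e : R) :
  e <= x - l -> e <= r - x -> `|x - t| < e -> l < t < r.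
Proof.
by move=> xl rx; rewrite ltr_distl => /andP[? ?]; apply/andP; split; lra.
Qed.

Section splitting_words.
Context (R : realType) (k : nat) (T : 'I_k.+1 -> unit_itv R -> unit_itv R).
Hypothesis cT : forall i, continuous (T i).
Hypothesis hA : exists x y, [/\ target_set T x, target_set T y & x <> y].
Variables a c : unit_itv R.
Hypothesis ac : val a < val c.
Let J := [set x : unit_itv R | val a <= val x <= val c].
Hypothesis TJ : forall i, T i @` J `<=` J.
Hypothesis Tinj : forall i, set_inj J (T i).

Lemma closed_segment : closed J.
Proof.
rewrite (_ : J = val @^-1` `[val a, val c]%classic).
  by apply: closed_comp => [x _|]; [exact: continuous_val|exact: itv_closed].
by apply/seteqP; split => x; rewrite /= in_itv.
Qed.

Lemma segment_nonempty : J !=set0.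
Proof. by exists a; rewrite /J/= lexx ltW. Qed.

Let AJ : target_set T `<=` J.
Proof.
by apply: target_set_sub segment_nonempty _; first exact: closed_segment.
Qed.

Let A_limit x (e : R) : target_set T x -> 0 < e ->
  exists2 y, target_set T y & x <> y /\ `|val x - val y| < e.
Proof.
by apply: (target_set_limit cT _ segment_nonempty TJ Tinj hA) => //;
  exact: closed_segment.
Qed.

(** A target point at an end of the segment is a limit of others, and those
    closer than the length of the segment are interior. *)
Let interior_target : exists2 z, target_set T z & val a < val z < val c.
Proof.
have [x [_ [Ax _ _]]] := hA.
have [xac|xac] := boolP (val a < val x < val c); first by exists x.
have ca0 : 0 < val c - val a by rewrite subr_gt0.
have [y Ay [xy xye]] := A_limit Ax ca0.
exists y => //; have /andP[ax xc] := AJ Ax; have /andP[ay yc] := AJ Ay.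
have xy' : val x != val y by apply/eqP => /val_inj.
move: xac; rewrite negb_and -!leNgt => /orP[xa|cx].
  have xaE : val x = val a by apply/eqP; rewrite eq_le xa ax.
  move: xye xy'; rewrite xaE distrC ger0_norm ?subr_ge0// ltrD2r => -> ay'.
  by rewrite andbT lt_neqAle ay'.
have xcE : val x = val c by apply/eqP; rewrite eq_le xc cx.
move: xye xy'; rewrite xcE ger0_norm ?subr_ge0// ltrD2l ltrN2 => -> cy'.
by rewrite lt_neqAle eq_sym cy'.
Qed.

(** Two distinct target points inside the segment are coded by sequences whose
    long prefixes have images in disjoint balls contained in the segment;
    taking prefixes of a common length costs nothing. *)
Lemma splitting_words : exists u v, [/\ size u = size v,
  range (word_map T u) `<=` J, range (word_map T v) `<=` J &
  range (word_map T u) `&` range (word_map T v) = set0].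
Proof.
have [z Az /andP[az zc]] := interior_target.
have e10 : 0 < Num.min (val z - val a) (val c - val z).
  by rewrite lt_min !subr_gt0 az.
have [y Ay [zy]] := A_limit Az e10.
rewrite lt_min => /andP[zya zyc].
have /andP[ay yc] : val a < val y < val c.
  have := @between_of_dist_lt _ (val a) (val c) (val z) (val y)
    (Num.min (val z - val a) (val c - val z)).
  by rewrite !ge_min !lexx orbT lt_min zya zyc; apply.
have zy0 : 0 < `|val z - val y|.
  by rewrite normr_gt0 subr_eq0; apply/eqP => /val_inj.
have in_J x (e : R) : e <= val x - val a -> e <= val c - val x ->
    forall t, `|val x - val t| < e -> J t.
  move=> e1 e2 t xt; have /andP[at_ tc] := between_of_dist_lt e1 e2 xt.
  by rewrite /J/= !ltW.
pose e := Num.min (`|val z - val y| / 2)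
  (Num.min (Num.min (val z - val a) (val c - val z))
           (Num.min (val y - val a) (val c - val y))).
have e0 : 0 < e.
  by rewrite !lt_min divr_gt0//= !subr_gt0 az zc ay yc.
have [ez [ea ec] [ea' ec']] : [/\ e <= `|val z - val y| / 2,
    (e <= val z - val a) /\ (e <= val c - val z) &
    (e <= val y - val a) /\ (e <= val c - val y)].
  by rewrite /e !ge_min !lexx !orbT.
have [xi hxi xiz] := Az; have [eta heta etay] := Ay.
have [n _ nP] := near_coding_map cT hxi e0.
have [m _ mP] := near_coding_map cT heta e0.
rewrite xiz in nP; rewrite etay in mP.
have {}nP := nP _ (leq_maxl n m); have {}mP := mP _ (leq_maxr n m).
exists (mkseq xi (maxn n m)), (mkseq eta (maxn n m)); split.
- by rewrite !size_mkseq.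
- by move=> x /nP; exact: in_J.
- by move=> x /mP; exact: in_J.
- apply/seteqP; split => // x [/nP zx /mP yx].
  have := ler_distD (val x) (val z) (val y).
  by rewrite leNgt (distrC (val x)) [ltRHS]splitr ltrD// (lt_le_trans _ ez).
Qed.

End splitting_words.

(** * Probability measures compared on closed sets *)

Section closed_sets_determine.
Context (R : realType).
Implicit Types m : probability (unit_itv R) R.

Lemma measurable_closed (F : set (unit_itv R)) : closed F -> measurable F.
Proof.
move=> cF; rewrite -[F]setCK; apply: measurableC.
by apply: sub_sigma_algebra; exact: closed_openC.
Qed.

Lemma measurable_open (U : set (unit_itv R)) : open U -> measurable U.
Proof. exact: sub_sigma_algebra. Qed.

Lemma open_Fsigma_nondecreasing (U : set (unit_itv R)) : open U ->
  exists F : (set (unit_itv R))^nat, [/\ forall n, closed (F n),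
    nondecreasing_seq F & \bigcup_n F n = U].
Proof.
move=> oU.
exists (fun n => \bigcap_(y in ~` U)
  [set x | n.+1%:R^-1 <= `|val x - val y|]); split.
- move=> n; apply: closed_bigI => y _.
  have cd : continuous (fun t : R => `|t - val y|).
    by move=> t; apply: cvg_norm; apply: cvgB; [exact: cvg_id|exact: cvg_cst].
  rewrite (_ : [set _ | _] = val @^-1`
    ((fun t : R => `|t - val y|) @^-1` [set t | n.+1%:R^-1 <= t]))//.
  apply: closed_comp => [x _|]; first exact: continuous_val.
  by apply: closed_comp => [t _|]; [exact: cd|exact: closed_ge].
- move=> n m nm; apply/subsetPset => x xn y Uy /=.
  by apply: le_trans (xn y Uy); rewrite lef_pV2 ?posrE// ler_nat.
apply/seteqP; split => [x [n _ xn]|x Ux].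
  apply: contrapT => /xn /=; rewrite subrr normr0 leNgt invr_gt0.
  by rewrite ltr0n.
have : nbhs x U by exact: open_nbhs_nbhs.
rewrite -nbhs_ballE => -[e /= e0 eU].
have [n _ /(_ n (leqnn n)) /= ne] := near_infty_natSinv_lt (PosNum e0).
exists n => // y Uy /=; rewrite leNgt; apply/negP => xy; apply: Uy.
by apply: eU; exact: lt_trans ne.
Qed.

(** The inequality passes to open sets, increasing unions of closed ones, and
    is reversed by taking complements since both total masses are 1. *)
Lemma closed_le_measure_eq m1 m2 :
  (forall F, closed F -> (m1 F <= m2 F)%E) -> m1 ≡μ m2.
Proof.
move=> m12.
have open_le U : open U -> (m1 U <= m2 U)%E.
  move=> oU; have [F [cF ndF FU]] := open_Fsigma_nondecreasing oU.
  have mU := measurable_open oU.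
  have mF n := measurable_closed (cF n).
  have : m1 \o F @ \oo --> m1 U.
    by rewrite -FU; apply: nondecreasing_cvg_mu => //; rewrite FU.
  move=> m1FU; rewrite -(cvg_lim _ m1FU)//; apply: lime_le.
    by apply/cvg_ex; exists (m1 U).
  apply: nearW => n /=; apply: (le_trans (m12 _ (cF n))).
  by apply: le_measure; rewrite ?inE// -FU; exact: bigcup_sup.
have open_eq U : open U -> m1 U = m2 U.
  move=> oU; apply/eqP; rewrite eq_le open_le//=.
  have := m12 _ (open_closedC oU).
  have mU := measurable_open oU.
  rewrite !probability_setC// -[m1 U]fineK ?fin_num_measure//.
  rewrite -[m2 U]fineK ?fin_num_measure// -!EFinB !lee_fin; lra.
apply: (measure_unique (@open (unit_itv R)) (fun=> setT)) => //.
- exact: openI.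
- by move=> _; exact: openT.
- by rewrite bigcup_const.
- by move=> _; rewrite [ltLHS]probability_setT ltry.
Qed.

End closed_sets_determine.

(** * The law of the coding map *)

Section coding_law.
Context (R : realType) (k : nat) (T : 'I_k.+1 -> unit_itv R -> unit_itv R).
Hypothesis cT : forall i, continuous (T i).
Variable p : 'I_k.+1 -> R.
Hypothesis hp : is_bernoulli_weight p.
Hypothesis cvg_wide : forall e : R, 0 < e ->
  word_mean p n (fun w => (wide T e w)%:R) @[n --> \oo] --> (0 : R).
Variable b : probability (symbol_seq k) R.
Hypothesis hb : is_bernoulli p b.

(** Diameters decrease along a sequence, so on a sequence that is not weakly
    hyperbolic all of them exceed some [m.+1%:R^-1]; for each [m] this has
    probability 0. *)
Lemma weakly_hyperbolic_ae : b (weakly_hyperbolic T) = 1%E.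
Proof.
have mS := measurable_weakly_hyperbolic T.
pose B m := \bigcap_n [set xi : symbol_seq k | wide T m.+1%:R^-1 (mkseq xi n)].
have mB n m :
    measurable [set xi : symbol_seq k | wide T m.+1%:R^-1 (mkseq xi n)].
  exact: (@measurable_prefix _ n [set w | wide T m.+1%:R^-1 w]).
have b0 m : b (B m) = 0%E.
  apply/eqP; rewrite eq_le measure_ge0 andbT; apply/lee_addgt0Pr => e e0.
  have m0 : 0 < m.+1%:R^-1 :> R by rewrite invr_gt0.
  have /cvgr0Pnorm_lt/(_ _ e0) [n _ /(_ n (leqnn n)) ne] := cvg_wide m0.
  rewrite add0e.
  apply: (@le_trans _ _ (b [set xi | wide T m.+1%:R^-1 (mkseq xi n)])).
    apply: le_measure; rewrite ?inE; [exact: bigcapT_measurable|exact: mB|].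
    exact: bigcap_inf.
  by rewrite (bernoulli_prefix hp hb) lee_fin (le_trans (ler_norm _))// ltW.
have negB : b.-negligible (\bigcup_m B m).
  by apply: negligible_bigcup => m; apply/negligibleP;
    [exact: bigcapT_measurable|exact: b0].
have : b.-negligible (~` weakly_hyperbolic T).
  apply: negligibleS negB => xi; apply: contra_notP => xiB.
  apply/cvgr0Pnorm_lt => e e0.
  have [m _ /(_ m (leqnn m)) /= me] := near_infty_natSinv_lt (PosNum e0).
  have [n xin] : exists n, ~ wide T m.+1%:R^-1 (mkseq xi n).
    by apply/existsNP => xin; apply: xiB; exists m => // n _; exact: xin.
  exists n => // j /= nj; rewrite ger0_norm ?diameter_ge0// comp_uptoE.
  apply: le_lt_trans me.
  apply: (@le_trans _ _ (diameter (range (word_map T (mkseq xi n))))).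
    by apply: diameter_le; apply: range_word_map_mkseq; exact: leqW.
  by rewrite leNgt; exact/negP.
move=> /(negligibleP b (measurableC mS)) bSC.
have := probability_setC b mS; rewrite [LHS]bSC => /esym/eqP.
by rewrite sube_eq ?fin_num_measure// add0e => /eqP <-.
Qed.

Lemma weakly_hyperbolicI_ae A : measurable A ->
  b (weakly_hyperbolic T `&` A) = b A.
Proof.
move=> mA; have mS := measurable_weakly_hyperbolic T.
rewrite -[in RHS](setTI A) -(setUv (weakly_hyperbolic T)) setIUl measureU//.
- rewrite [X in (_ + X)%E](_ : _ = 0%E) ?adde0//; apply/eqP.
  rewrite eq_le measure_ge0 andbT.
  apply: (@le_trans _ _ (b (~` weakly_hyperbolic T))).
    by apply: le_measure; rewrite ?inE;
      [apply: measurableI => //; exact: measurableC|exact: measurableC|].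
  by rewrite probability_setC// weakly_hyperbolic_ae subee.
- exact: measurableI.
- by apply: measurableI => //; exact: measurableC.
- by rewrite setIACA setICr set0I.
Qed.

(** On a weakly hyperbolic sequence the images of the prefixes are nested closed
    sets that shrink to the coded point, so all of them meet the closed set [F]
    exactly when [F] contains that point; continuity from above concludes. *)
Lemma cvg_hit_coding_law F : closed F ->
  (word_mean p n (fun w => (hit T F w)%:R))%:E @[n --> \oo] -->
  coding_law T b F.
Proof.
move=> cF.
pose H n := [set xi : symbol_seq k | hit T F (mkseq xi n)].
have mH n : measurable (H n).
  exact: (@measurable_prefix _ n [set w | hit T F w]).
have mHoo : measurable (\bigcap_n H n) by exact: bigcapT_measurable.
have -> : coding_law T b F = b (\bigcap_n H n).
  rewrite -weakly_hyperbolicI_ae//; congr (b _); apply/seteqP; split.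
    move=> xi [hxi Fxi]; split => // n _; apply/asboolP.
    by exists (coding_map T xi); split => //; exact: coding_map_range.
  move=> xi [hxi Hxi]; split => //; apply: contrapT => nF.
  have : nbhs (coding_map T xi) (~` F).
    by apply: open_nbhs_nbhs; split => //; exact: closed_openC.
  rewrite -nbhs_ballE => -[e /= e0 eF].
  have [n _ /(_ n (leqnn n)) nP] := near_coding_map cT hxi e0.
  have /asboolP [x [Fx Tx]] := Hxi n I.
  by apply: (eF x) => //; exact: nP.
rewrite (_ : (fun n => _) = b \o H); last first.
  by apply/funext => n /=; rewrite /H (bernoulli_prefix hp hb).
apply: nonincreasing_cvg_mu => //.
  by rewrite (le_lt_trans (probability_le1 _ _))// ltry.
move=> n m nm; apply/subsetPset => xi /asboolP [x [Fx Tx]]; apply/asboolP.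
by exists x; split => //; apply: (range_word_map_mkseq nm).
Qed.

Lemma coding_law_setT : coding_law T b setT = 1%E.
Proof. by rewrite /coding_law preimage_setT setIT weakly_hyperbolic_ae. Qed.

Let coding_measure : set (unit_itv R) -> \bar R := coding_law T b.

HB.instance Definition _ := Measure.on coding_measure.
HB.instance Definition _ :=
  Measure_isProbability.Build _ _ _ coding_measure coding_law_setT.

Definition coding_probability : probability (unit_itv R) R := coding_measure.

Lemma continuous_closed_preimage i F : closed F -> closed (T i @^-1` F).
Proof. by move=> cF; apply: closed_comp => // x _; exact: cT. Qed.

(** On a closed set both sides are limits of means of [hit]: the Markov
    operator adds one letter in front of the word. *)
Lemma stationary_coding_probability : stationary cT hp coding_probability.
Proof.
apply: closed_le_measure_eq => F cF.
rewrite le_eqVlt; apply/orP; left; apply/eqP.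
have := cvg_hit_coding_law cF; rewrite -(cvg_shiftS _) /= => lim1.
have lim2 : (word_mean p n.+1 (fun w => (hit T F w)%:R))%:E @[n --> \oo] -->
    markov_operator cT hp coding_probability F.
  rewrite (_ : (fun n => _) = fun n => (\sum_i (p i)%:E *
     (word_mean p n (fun w => (hit T (T i @^-1` F) w)%:R))%:E)%E); last first.
    apply/funext => n /=; rewrite -sumEFin; apply: eq_bigr => i _.
    by rewrite EFinM; congr (_ * _%:E)%E; apply: eq_word_mean => // w _;
      rewrite hit_cons.
  apply: cvg_nnesum => [i _|i _].
    apply: nearW => n; rewrite -EFinM lee_fin; apply: mulr_ge0.
      by rewrite ltW//; case: hp.
    exact: word_mean_ge0.
  apply: cvgeZl => //; apply: cvg_hit_coding_law.
  exact: continuous_closed_preimage.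
exact: (etrans (esym (cvg_lim (@ereal_hausdorff R) lim2))
  (cvg_lim (@ereal_hausdorff R) lim1)).
Qed.

(** Iterating stationarity writes [mu F] as the mean over words [w] of the mass
    of the preimage of [F] by [word_map T w]. That preimage is empty when the
    image of [w] misses [F]; otherwise its mass is at most 1. *)
Lemma stationary_le_hit_mean (mu : probability (unit_itv R) R) n F :
  stationary cT hp mu -> closed F ->
  (mu F <= (word_mean p n (fun w => (hit T F w)%:R))%:E)%E.
Proof.
move=> smu; elim: n F => [|n IH] F cF.
  rewrite /=; have [hF|] := boolP (hit T F [::]).
    exact: probability_le1 (measurable_closed cF).
  move=> /asboolPn hF; rewrite (_ : F = set0) ?measure0//.
  by apply/seteqP; split => // x Fx; apply: hF; exists x; split => //; exists x.
rewrite -(smu _ (measurable_closed cF)) /= -sumEFin.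
apply: lee_sum => i _; rewrite EFinM; apply: lee_wpmul2l.
  by rewrite lee_fin ltW//; case: hp.
apply: le_trans (IH _ (continuous_closed_preimage (i := i) cF)) _.
by rewrite lee_fin; apply: le_word_mean => // w _; rewrite hit_cons.
Qed.

Lemma stationary_unique (mu : probability (unit_itv R) R) :
  stationary cT hp mu -> mu ≡μ coding_law T b.
Proof.
move=> smu; apply: (@closed_le_measure_eq _ mu coding_probability) => F cF.
apply: (cvge_to_ge (cvg_hit_coding_law cF)).
by apply: nearW => n; exact: stationary_le_hit_mean.
Qed.

(** Around a target point [coding_map T xi], a neighbourhood contains the image
    of a prefix of [xi], and the cylinder of that prefix has positive mass. *)
Lemma msupport_coding_law : msupport (coding_law T b) = closure (target_set T).
Proof.
apply/seteqP; split => x.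
  move=> xs U; rewrite nbhsE => -[V [oV Vx] VU].
  apply: contrapT => UA; have := xs V oV Vx.
  rewrite /coding_law (_ : _ `&` _ = set0) ?measure0 ?ltxx//.
  apply/seteqP; split => // xi [hxi Vxi]; apply: UA.
  by exists (coding_map T xi); split; [exists xi|exact: VU].
move=> xA U oU Ux.
have [_ [[xi hxi <-] Upi]] := xA U (open_nbhs_nbhs (conj oU Ux)).
have : nbhs (coding_map T xi) U by apply: open_nbhs_nbhs.
rewrite -nbhs_ballE => -[e /= e0 eU].
have [n _ /(_ n (leqnn n)) nP] := near_coding_map cT hxi e0.
pose C := [set eta : symbol_seq k | mkseq eta (size (mkseq xi n)) = mkseq xi n].
have mC : measurable C.
  exact: (@measurable_prefix _ (size (mkseq xi n)) [set mkseq xi n]).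
apply: (@lt_le_trans _ _ (b C)).
  by rewrite (bernoulli_cylinder hb) lte_fin word_weight_gt0.
rewrite -weakly_hyperbolicI_ae//.
apply: le_measure; rewrite ?inE.
- by apply: measurableI => //; exact: measurable_weakly_hyperbolic.
- apply: measurable_coding_map; first exact: measurable_weakly_hyperbolic.
  exact: measurable_open.
move=> eta [heta Ceta]; split => //; apply: eU; apply: nP.
by rewrite -Ceta; exact: coding_map_range.
Qed.

Lemma no_atom_coding_law :
  (forall x, word_mean p n (fun w => (hit T [set x] w)%:R) @[n --> \oo] -->
    (0 : R)) ->
  no_atom (coding_law T b).
Proof.
move=> hx x.
have cx : closed [set x].
  apply: accessible_closed_set1; apply: hausdorff_accessible.
  exact: unit_itv_hausdorff.
rewrite -(cvg_lim _ (cvg_hit_coding_law cx))//.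
by apply: cvg_lim => //; apply: cvg_EFin; [exact: nearW|exact: hx].
Qed.

End coding_law.

(** * Weak convergence of the iterates of the Markov operator *)

Section markov_integral.
Context (R : realType) (k : nat) (T : 'I_k.+1 -> unit_itv R -> unit_itv R).
Hypothesis cT : forall i, continuous (T i).
Variable p : 'I_k.+1 -> R.
Hypothesis hp : is_bernoulli_weight p.
Implicit Types (mu : probability (unit_itv R) R) (f : unit_itv R -> R).

Lemma continuous_measurable f : continuous f -> measurable_fun setT f.
Proof.
move=> cf; apply: (measurability _ (RGenOpens.measurableE R)) => //.
move=> _ [_ [x [y ->]] <-]; rewrite setTI; apply: sub_sigma_algebra.
by apply: open_comp => [z _|]; [exact: cf|exact: interval_open].
Qed.

Lemma continuous_integrable mu f : continuous f ->
  mu.-integrable setT (EFin \o f).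
Proof.
move=> cf; apply: measurable_bounded_integrable => //.
- by rewrite [ltLHS]probability_setT ltry.
- exact: continuous_measurable.
- have [C fC] := unit_itv_bounded cf.
  exists C; split; first exact: num_real.
  by move=> M /ltW CM x _; exact: le_trans (fC x) CM.
Qed.

Let mT i : measurable_fun setT (T i).
Proof.
apply: (@measurability _ _ _ _ _ _ (@open (unit_itv R))) => //.
move=> _ [V oV <-]; rewrite setTI; apply: sub_sigma_algebra.
by apply: open_comp oV => x _; apply: cT.
Qed.

Lemma ge0_integral_markov mu f :
  measurable_fun setT f -> (forall x, 0 <= f x) ->
  (\int[markov_operator cT hp mu]_x (f x)%:E =
   \sum_i (p i)%:E * \int[mu]_x (f (T i x))%:E)%E.
Proof.
move=> mf f0.
have p0 i : 0 <= p i by rewrite ltW//; case: hp.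
pose m_ n : {measure set (unit_itv R) -> \bar R} :=
  mscale (NngNum (p0 (inord n))) (giry_map (mT (inord n)) mu).
have mEf : measurable_fun setT (EFin \o f) by exact/measurable_EFinP.
rewrite (eq_measure_integral (msum m_ k.+1)); last first.
  move=> A mA _; change (markov_fun T p mu A = \sum_(n < k.+1) m_ n A)%E.
  rewrite /markov_fun; apply: eq_bigr => i _.
  by rewrite /m_ /mscale /= inord_val.
rewrite ge0_integral_measure_sum//; last by move=> x _; rewrite lee_fin.
apply: eq_bigr => i _.
rewrite ge0_integral_mscale//=; last by move=> x _; rewrite lee_fin.
rewrite inord_val; congr (_ * _)%E.
by apply: (@giry_int_map _ _ _ _ _ _ (mT i) mu) => // x; rewrite lee_fin.
Qed.

Lemma RintegralDcst mu f C : continuous f ->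
  \int[mu]_x (f x + C) = \int[mu]_x f x + C.
Proof.
move=> cf; rewrite RintegralD//; first last.
- by apply: continuous_integrable; exact: cst_continuous.
- exact: continuous_integrable.
by rewrite Rintegral_cst// [X in fine X]probability_setT mulr1.
Qed.

(** Adding a bound [C] of [f] makes it nonnegative, which is the case of
    [ge0_integral_markov]. *)
Lemma Rintegral_markov mu f : continuous f ->
  \int[markov_operator cT hp mu]_x f x = \sum_i p i * \int[mu]_x f (T i x).
Proof.
move=> cf; have [C fC] := unit_itv_bounded cf.
have cfT i : continuous (f \o T i).
  by move=> x; apply: (@continuous_comp _ _ _ (T i) f); [exact: cT|exact: cf].
have cfC g : continuous g -> continuous (fun x : unit_itv R => g x + C).
  have cadd : continuous (fun t : R => t + C).
    by move=> t; apply: cvgD; [exact: cvg_id|exact: cvg_cst].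
  by move=> cg x; apply: (@continuous_comp _ _ _ g (fun t => t + C));
    [exact: cg|exact: cadd].
apply: (addIr C); rewrite -RintegralDcst//.
have fC0 x : 0 <= f x + C.
  by have := fC x; rewrite ler_norml => /andP[+ _]; rewrite -subr_ge0 opprK.
have mfC := continuous_measurable (cfC _ cf).
rewrite /Rintegral (ge0_integral_markov mu mfC fC0).
have fin i : (\int[mu]_x (f (T i x) + C)%:E)%E \is a fin_num.
  by apply: integrable_fin_num => //; apply: continuous_integrable;
    exact: (cfC _ (cfT i)).
rewrite -sum_fine; last by move=> i _; rewrite fin_numM.
transitivity (\sum_i p i * (\int[mu]_x f (T i x) + C)).
  apply: eq_bigr => i _; rewrite fineM//=; congr (_ * _).
  by rewrite -(RintegralDcst mu C (cfT i)).
under eq_bigr do rewrite mulrDr.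
by rewrite big_split/= -mulr_suml; have [_ ->] := hp; rewrite mul1r.
Qed.

Lemma Rintegral_dist mu f (B : R) x0 : continuous f ->
  (forall x, `|f x - f x0| <= B) -> `|\int[mu]_x f x - f x0| <= B.
Proof.
move=> cf fB.
have cst_int c : \int[mu]_x c = c.
  by rewrite Rintegral_cst// [X in fine X]probability_setT mulr1.
have int_cst c : mu.-integrable setT (EFin \o cst c).
  by apply: continuous_integrable; exact: cst_continuous.
have fint := continuous_integrable mu cf.
rewrite ler_distl; apply/andP; split.
  rewrite -(cst_int (f x0 - B)).
  apply: le_Rintegral => [//|||x _]; [exact: int_cst|exact: fint|].
  by have := fB x; rewrite ler_distl => /andP[].
rewrite -(cst_int (f x0 + B)).
apply: le_Rintegral => [//|||x _]; [exact: fint|exact: int_cst|].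
by have := fB x; rewrite ler_distl => /andP[].
Qed.

(** Integrating [f] against an iterate is averaging [f \o word_map T w] over
    words [w] and then over the initial law, and the initial law only matters
    up to the oscillation of this function. *)
Lemma iter_markov_dist mu nu n f (G : seq 'I_k.+1 -> R) :
  stationary cT hp nu -> continuous f ->
  (forall w x y, `|f (word_map T w x) - f (word_map T w y)| <= G w) ->
  `|\int[iter n (markov_operator cT hp) mu]_x f x - \int[nu]_x f x| <=
  2 * word_mean p n G.
Proof.
move=> snu; elim: n f G => [|n IH] f G cf fG.
  have fB x : `|f x - f (unit_itv0 R)| <= G [::] by exact: (fG [::]).
  have h1 := Rintegral_dist mu cf fB; have h2 := Rintegral_dist nu cf fB.
  apply: (le_trans (ler_distD (f (unit_itv0 R)) _ _)).
  by rewrite (distrC (f _)) /= mulr_natl mulr2n lerD.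
have -> : \int[nu]_x f x = \int[markov_operator cT hp nu]_x f x.
  by congr fine; apply: eq_measure_integral => A mA _; rewrite -(snu _ mA).
rewrite iterS !Rintegral_markov// -sumrB /= mulr_sumr.
apply: le_trans (ler_norm_sum _ _ _) _; apply: ler_sum => i _.
have p0 : 0 <= p i by rewrite ltW//; case: hp.
rewrite -mulrBr normrM ger0_norm// mulrCA ler_wpM2l//.
apply: (IH (f \o T i) (fun w => G (i :: w))); last first.
  by move=> w x y; exact: (fG (i :: w)).
by move=> x; apply: (@continuous_comp _ _ _ (T i) f); [exact: cT|exact: cf].
Qed.

Hypothesis cvg_wide : forall e : R, 0 < e ->
  word_mean p n (fun w => (wide T e w)%:R) @[n --> \oo] --> (0 : R).

Lemma weak_cvg_iter_markov mu nu : stationary cT hp nu ->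
  weak_cvg (fun n => iter n (markov_operator cT hp) mu) nu.
Proof.
move=> snu f cf; have [C fC] := unit_itv_bounded cf.
apply/cvgrPdist_lt => e e0.
have e40 : 0 < e / 4 by rewrite divr_gt0.
have [d d0 fd] := unit_itv_uniform_continuity cf e40.
have d20 : 0 < d / 2 by rewrite divr_gt0.
(* a bound of the oscillation of [f] over the image of [w], small unless the
   image is wide *)
pose G w := e / 4 + (2 * C) * (wide T (d / 2) w)%:R.
have C0 : 0 <= C by apply: le_trans (fC (unit_itv0 R)).
have fG w x y : `|f (word_map T w x) - f (word_map T w y)| <= G w.
  rewrite /G; have [_|nw] := boolP (wide T (d / 2) w).
    rewrite mulr1; apply: (le_trans (ler_normB _ _)).
    have := fC (word_map T w x); have := fC (word_map T w y); lra.
  rewrite mulr0 addr0 ltW// fd//.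
  apply: (@le_lt_trans _ _ (d / 2)); last by lra.
  apply: (@le_trans _ _ (diameter (range (word_map T w)))).
    by apply: ler_diameter; eexists.
  by rewrite leNgt.
have e160 : 0 < e / (16 * (C + 1)) by rewrite divr_gt0// mulr_gt0//; lra.
have /cvgr0Pnorm_lt/(_ _ e160) [N _ NP] := cvg_wide d20.
exists N => // n /NP wn; rewrite distrC.
apply: le_lt_trans (iter_markov_dist mu n snu cf fG) _.
rewrite /G word_meanD word_mean_cst// word_meanZ.
have {}wn := le_lt_trans (ler_norm _) wn.
have : (2 * C) * word_mean p n (fun w => (wide T (d / 2) w)%:R) <= e / 8.
  apply: (@le_trans _ _ (2 * C * (e / (16 * (C + 1))))).
    by rewrite ler_wpM2l ?mulr_ge0// ltW.
  rewrite mulrA ler_pdivrMr; last by rewrite mulr_gt0//; lra.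
  nra.
lra.
Qed.

End markov_integral.

(** * Stability *)

Theorem theorem4 (R : realType) (k : nat) (hk : (2 <= k.+1)%N)
    (T : 'I_k.+1 -> unit_itv R -> unit_itv R)
    (cT : forall i, continuous (T i))
    (hA : exists x y, [/\ target_set T x, target_set T y & x <> y])
    (hJ : exists a c : unit_itv R, val a < val c /\
      let J := [set x : unit_itv R | val a <= val x <= val c] in
      forall i, T i @` J `<=` J /\ set_inj J (T i)) :
  (forall (p : 'I_k.+1 -> R) (hp : is_bernoulli_weight p)
      (b : probability (symbol_seq k) R), is_bernoulli p b ->
    [/\ asymptotically_stable cT hp,
        (exists2 nu : probability (unit_itv R) R,
          nu ≡μ coding_law T b & stationary cT hp nu) /\
        (forall mu : probability (unit_itv R) R,
          stationary cT hp mu -> mu ≡μ coding_law T b),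
        msupport (coding_law T b) = closure (target_set T) &
        no_atom (coding_law T b)]) /\
  isolated (target_set T) = set0.
Proof.
have [a [c [ac /= TJ']]] := hJ.
set J := [set x | _] in TJ'.
have TJ i : T i @` J `<=` J by case: (TJ' i).
have Tinj i : set_inj J (T i) by case: (TJ' i).
split; last first.
  exact: (isolated_target_set cT (@closed_segment R a c) (segment_nonempty ac)
    TJ Tinj hA).
move=> p hp b hb.
have [u [v [uv uJ vJ uv0]]] := splitting_words cT hA ac TJ Tinj.
have cvg_hit := cvg_hit_mean TJ Tinj hp uv uJ vJ uv0.
have wide0 := cvg_wide_mean cT TJ Tinj hp uv uJ vJ uv0.
have nu_stationary := stationary_coding_probability cT hp wide0 hb.
split.
- exists (coding_probability hp wide0 hb) => // mu.
  exact: weak_cvg_iter_markov.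
- split; last by move=> mu smu; exact: (stationary_unique wide0 hb smu).
  by exists (coding_probability hp wide0 hb).
- exact: (msupport_coding_law cT hp wide0 hb).
- exact: (no_atom_coding_law cT hp wide0 hb cvg_hit).
Qed.
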